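(* Let $\mathbf{t}=(t_1,\dots,t_n)$ be a sequence of positive integers and let $\lambda_i=t_i+t_{i+1}+\cdots+t_n$ for $1\le i\le n$. Then the number of distinct monomials in $$\Omega_n(\lambda)=\prod_{i=1}^n\sum_{j=1}^{\lambda_i}x_j$$ equals the number of lattice points $\#\Pi_n(t_1,\dots,t_{n-1},t_n-1)$ in the polytope $\Pi_n(t_1,\dots,t_{n-1},t_n-1)$.
   Context: For real numbers $s_1,\dots,s_n\ge 0$, the (Pitman–Stanley) polytope is $$\Pi_n(s_1,\dots,s_n)=\{\mathbf{y}\in\mathbb{R}^n:\ y_i\ge 0\text{ and }y_1+\cdots+y_i\le s_n+s_{n-1}+\cdots+s_{n-i+1}\text{ for all }1\le i\le n\}.$$ Lattice points are points of $\mathbb{Z}^n$. $\Omega_n(\lambda)$ is a polynomial with integer coefficients; its distinct monomials are those with nonzero coefficient. *)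

(* Defs.v *)
From HB Require Import structures.
From mathcomp Require Export all_boot all_order all_algebra.
From mathcomp Require Export classical_sets functions cardinality reals.
From mathcomp Require Export mpoly.

Set Implicit Arguments.
Unset Strict Implicit.
Unset Printing Implicit Defensive.

Import Order.TTheory GRing.Theory Num.Theory.
Local Open Scope classical_set_scope.
Local Open Scope ring_scope.

(* Indices start at 0: [s i] stands for s_{i+1}, [y 0 i] for y_{i+1}.
   The right-hand side below is the sum of the last i+1 terms of s, i.e. of
   those of index j >= n - (i+1); writing this as n <= j + i.+1 avoids the
   truncated subtraction. *)
Definition pitman_stanley (R : realType) (n : nat) (s : 'I_n -> R) :
    set 'rV[R]_n :=
  [set y : 'rV[R]_n | forall i : 'I_n, 0 <= y 0 i /\
     \sum_(j < n | (j <= i)%N) y 0 j <= \sum_(j < n | (n <= j + i.+1)%N) s j].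

Definition lattice_points (R : realType) (n : nat) : set 'rV[R]_n :=
  [set y : 'rV[R]_n | forall i : 'I_n, y 0 i \is a Num.int].

(* The ambient ring has exactly the variables x_1, ..., x_{max_i lam_i}, which
   are those occurring in the product; 'X_j stands for x_{j+1}. *)
Definition Omega (n : nat) (lam : 'I_n -> nat) :
    {mpoly int[\max_(i < n) lam i]} :=
  \prod_(i < n) \sum_(j < \max_(i < n) lam i | (j < lam i)%N) 'X_j.

(* [msupp p] lists without repetition the monomials of nonzero coefficient. *)
Definition nb_monomials (N : nat) (p : {mpoly int[N]}) : nat :=
  size (msupp p).

(* Main.v *)
(* A point y of the polytope is determined by its partial sums
   z_i = y_1 + ... + y_i; since s_n + ... + s_(n-i+1) = lambda_(n-i+1) - 1, the
   lattice points are in bijection with the sequences of naturals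
   z_1 <= ... <= z_n with z_i < lambda_(n-i+1).  Sending z to the product of the
   x_(z_i + 1) gives exactly the monomials of Omega_n(lambda): no cancellation
   occurs in the expansion, and because lambda is nonincreasing, a choice
   (j_i) with j_i < lambda_i still satisfies these bounds after sorting. *)
Require Import Defs.

Set Implicit Arguments.
Unset Strict Implicit.

Import Order.TTheory GRing.Theory Num.Theory.
Local Open Scope classical_set_scope.
Local Open Scope card_scope.
Local Open Scope ring_scope.

(** * Monomials in the expansion of a product of sums of variables *)

Definition occ_mnm (N : nat) (s : seq nat) : 'X_{1.. N} :=
  [multinom count_mem (j : nat) s | j < N].

Lemma perm_occ_mnm (N : nat) (s s' : seq nat) :
  perm_eq s s' -> occ_mnm N s = occ_mnm N s'.
Proof. by move=> /permP ss'; apply/mnmP => j; rewrite !mnmE ss'. Qed.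

(** Entries that are at least [N] leave no trace in [occ_mnm N], whence the two bounds; below [N],
    the exponents record every multiplicity. *)
Lemma occ_mnm_perm (N : nat) (s s' : seq nat) :
  {in s, forall x, x < N}%N -> {in s', forall x, x < N}%N ->
  occ_mnm N s = occ_mnm N s' -> perm_eq s s'.
Proof.
move=> sN s'N /mnmP E; apply/allP => x; rewrite mem_cat => xs.
have xN : (x < N)%N by case/orP: xs => [/sN|/s'N].
by have := E (Ordinal xN); rewrite !mnmE /= => ->.
Qed.

Lemma occ_mnm_codom (N n : nat) (f : 'I_n -> 'I_N) :
  occ_mnm N [seq val (f i) | i <- enum 'I_n] = (\sum_(i < n) U_(f i))%MM.
Proof.
apply/mnmP => j; rewrite mnmE mnm_sumE count_map -sum1_count big_enum_cond /=.
rewrite big_mkcond /=; apply: eq_bigr => i _; rewrite mnm1E.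
by rewrite -val_eqE /=; case: ifP.
Qed.

(** Expanding the product gives one monomial per choice function [f], so the coefficient of [m] is a
    sum of integers equal to 0 or 1. Such a sum vanishes only if all its terms do. *)
Lemma msupp_prod_sumX (N n : nat) (P : 'I_n -> pred 'I_N) (m : 'X_{1.. N}) :
  reflect (exists2 f : 'I_n -> 'I_N,
             forall i, P i (f i) & m = (\sum_(i < n) U_(f i))%MM)
    (m \in msupp (\prod_(i < n) \sum_(j < N | P i j) 'X_j : {mpoly int[N]})).
Proof.
rewrite mcoeff_msupp bigA_distr_big_dep raddf_sum /=.
under eq_bigr => f _ do rewrite mprodXE mcoeffX.
rewrite psumr_neq0; last by move=> f _; rewrite ler0n.
apply: (iffP hasP) => [[f _ /andP[/familyP fP]]|[f fP ->]].
  by rewrite ltr0n lt0b => /eqP <-; exists f.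
exists [ffun i => f i]; first by rewrite mem_index_enum.
apply/andP; split; first by apply/familyP => i; rewrite ffunE; exact: fP.
by under eq_bigr do rewrite ffunE; rewrite eqxx.
Qed.

(** The common encoding of both sides: sorted variable indices of a monomial, or partial sums of a
    lattice point. With [lam] nonincreasing, [rev_ord] makes the bounds grow along [s]. *)
Definition staircase_seq (n : nat) (lam : 'I_n -> nat) (s : seq nat) : Prop :=
  [/\ size s = n, sorted leq s &
      forall i : 'I_n, (nth 0 s i < lam (rev_ord i))%N].

Lemma staircase_seq_lt (n N : nat) (lam : 'I_n -> nat) (s : seq nat) :
  (forall i, lam i <= N)%N -> staircase_seq lam s ->
  {in s, forall x, x < N}%N.
Proof.
move=> lamN [sz _ sl] x /(nthP 0)[k]; rewrite sz => kn <-.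
exact: leq_trans (sl (Ordinal kn)) (lamN _).
Qed.

(* If the i-th smallest value were at least L = lam (n - 1 - i), then n - i of
   the values would be, while f l >= L forces l < n - 1 - i. *)
Lemma sort_staircase_seq (n : nat) (lam f : 'I_n -> nat) :
  (forall i j : 'I_n, (i <= j)%N -> (lam j <= lam i)%N) ->
  (forall i, (f i < lam i)%N) ->
  staircase_seq lam (sort leq [seq f i | i <- enum 'I_n]).
Proof.
move=> lam_anti flam; set s := sort _ _.
have sz : size s = n by rewrite size_sort size_map size_enum_ord.
have ss : sorted leq s by apply: sort_sorted; exact: leq_total.
split=> // i; rewrite ltnNge; apply/negP; set L := lam _ => Ls.
have : (count (leq L) s <= n - i.+1)%N.
  rewrite (permP (permEl (perm_sort _ _))) count_map -sum1_count big_enum_cond.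
  rewrite sum1_card.
  suff : ([pred l : 'I_n | (L <= f l)%N]
      \subset [pred l : 'I_n | (l < n - i.+1)%N])%B.
    move/subset_leq_card/leq_trans; apply; rewrite -sum1_card.
    rewrite (eq_bigl (fun l : 'I_n => (l < n - i.+1)%N)) //.
    by rewrite (big_ord_narrow (leq_subr i.+1 n)) sum1_card card_ord.
  apply/fintype.subsetP => l; rewrite !inE; apply: contraTltn.
  move=> /(lam_anti (rev_ord i) l) lL.
  by rewrite -ltnNge; exact: leq_trans (flam l) lL.
apply/negP; rewrite -ltnNge.
have : (n - i <= count (leq L) s)%N.
  rewrite -(cat_take_drop i s) count_cat.
  have -> : count (leq L) (drop i s) = (n - i)%N.
    rewrite -{2}sz -size_drop; apply/eqP; rewrite -all_count.
    apply/(all_nthP 0) => k; rewrite size_drop sz => kn.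
    rewrite nth_drop; apply: leq_trans Ls _.
    apply: (sorted_leq_nth leq_trans leqnn) => //.
    - by rewrite inE sz.
    - by rewrite inE sz -ltn_subRL.
    - exact: leq_addr.
  exact: leq_addl.
by apply: leq_trans; rewrite subnSK.
Qed.

Lemma msupp_prod_staircase (N n : nat) (lam : 'I_n -> nat) (m : 'X_{1.. N}) :
  (forall i, lam i <= N)%N ->
  (forall i j : 'I_n, (i <= j)%N -> (lam j <= lam i)%N) ->
  m \in msupp (\prod_(i < n) \sum_(j < N | (j < lam i)%N) 'X_j
               : {mpoly int[N]}) <->
  exists2 s, staircase_seq lam s & m = occ_mnm N s.
Proof.
move=> lamN lam_anti; split.
  move=> /msupp_prod_sumX[f fl ->].
  exists (sort leq [seq val (f i) | i <- enum 'I_n]).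
    exact: (@sort_staircase_seq n lam (val \o f)).
  by rewrite -occ_mnm_codom; apply: perm_occ_mnm; rewrite perm_sym perm_sort.
move=> [s st ->]; have sN := staircase_seq_lt lamN st; case: st => sz _ sl.
apply/msupp_prod_sumX.
have s_lt (i : 'I_n) : (nth 0 s (rev_ord i) < N)%N.
  by apply/sN/mem_nth; rewrite sz.
(* Reading [s] backwards is already a legal choice: factor [i] receives the entry at [rev_ord i],
   which is bounded by [lam i]. *)
exists (fun i => Ordinal (s_lt i)) => [i /=|].
  by rewrite -[i in lam i]rev_ordK; exact: (sl (rev_ord i)).
rewrite -occ_mnm_codom; apply: perm_occ_mnm.
have -> : [seq val (Ordinal (s_lt i)) | i <- enum 'I_n] = rev s.
  apply: (@eq_from_nth _ 0) => [|k]; rewrite size_map size_enum_ord.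
    by rewrite size_rev sz.
  move=> kn; rewrite (nth_map (Ordinal kn)) ?size_enum_ord //=.
  by rewrite nth_enum_ord // nth_rev sz.
by rewrite perm_sym perm_rev.
Qed.

(** * Lattice points of the polytope and their partial sums *)

Definition partial_sum (R : realType) (n : nat) (y : 'rV[R]_n) (i : 'I_n) : R :=
  \sum_(j < n | (j <= i)%N) y 0 j.

(** Strong induction on the index: once the earlier coordinates agree, they cancel from the partial
    sums and leave the last one. *)
Lemma partial_sum_inj (R : realType) (n : nat) (y y' : 'rV[R]_n) :
  partial_sum y =1 partial_sum y' -> y = y'.
Proof.
move=> yy'; apply/rowP => i; have [k] := ubnP (val i).
elim: k i => // k IH i; rewrite ltnS => ik; have := yy' i.
rewrite /partial_sum (bigD1 i) //= [RHS](bigD1 i) //=.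
suff -> : \sum_(j < n | (j <= i)%N && (j != i)) y 0 j =
          \sum_(j < n | (j <= i)%N && (j != i)) y' 0 j by move/addIr.
apply: eq_bigr => j /andP[ji nji]; apply: IH; apply: leq_trans ik.
by rewrite ltn_neqAle nji.
Qed.

Lemma sum_widen_ord (V : zmodType) (n i : nat) (F : nat -> V) : (i < n)%N ->
  \sum_(j < n | (j <= i)%N) F j = \sum_(0 <= j < i.+1) F j.
Proof.
move=> lin; rewrite (big_nat_widen _ _ n) // big_mkord; exact: eq_bigl.
Qed.

(** [Num.truncn] is meant only as a change of type: at lattice points with nonnegative coordinates
    it loses nothing. *)
Definition heights (R : realType) (n : nat) (y : 'rV[R]_n) : seq nat :=
  [seq Num.truncn (partial_sum y i) | i <- enum 'I_n].

Lemma nth_heights (R : realType) (n : nat) (y : 'rV[R]_n) (i : 'I_n) :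
  (forall i, 0 <= y 0 i) -> @lattice_points R n y ->
  (nth 0 (heights y) i)%:R = partial_sum y i.
Proof.
move=> y0 yZ; rewrite (nth_map i) ?size_enum_ord // nth_ord_enum truncnK //.
by apply: rpred_sum => j _; rewrite natrEint y0 andbT; exact: yZ.
Qed.

(** The inverse construction to [heights]: consecutive differences, where the leading 0 makes the
    first coordinate the first entry of [s]. *)
Definition steps (R : realType) (n : nat) (s : seq nat) : 'rV[R]_n :=
  \row_i ((nth 0 (0 :: s)%N i.+1)%:R - (nth 0 (0 :: s)%N i)%:R).

Lemma partial_sum_steps (R : realType) (n : nat) (s : seq nat) (i : 'I_n) :
  partial_sum (steps R n s) i = (nth 0 s i)%:R.
Proof.
rewrite /partial_sum; under eq_bigr => j _ do rewrite mxE.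
rewrite (sum_widen_ord (fun j => (nth 0 (0 :: s)%N j.+1)%:R
                             - (nth 0 (0 :: s)%N j)%:R)) //.
by rewrite (telescope_sumr (fun j => (nth 0 (0 :: s)%N j)%:R)) //= subr0.
Qed.

Lemma steps_ge0 (R : realType) (n : nat) (s : seq nat) (i : 'I_n) :
  size s = n -> sorted leq s -> 0 <= steps R n s 0 i.
Proof.
move=> sz ss; rewrite mxE subr_ge0 ler_nat.
have ss0 : sorted leq (0 :: s)%N by rewrite /= path_min_sorted //; exact/allP.
apply: (sorted_leq_nth leq_trans leqnn 0 ss0); rewrite ?inE /= ?sz ?ltnS //.
exact: ltnW.
Qed.

Lemma heights_steps (R : realType) (n : nat) (s : seq nat) :
  size s = n -> heights (steps R n s) = s.
Proof.
move=> sz; apply: (@eq_from_nth _ 0) => [|k]; rewrite size_map size_enum_ord //.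
move=> kn; rewrite (nth_map (Ordinal kn)) ?size_enum_ord //.
by rewrite partial_sum_steps nth_enum_ord // natrK.
Qed.

(** The range of summation is that of [lam (rev_ord i)], and it always contains the last index, so
    the correction -1 enters exactly once. *)
Lemma pitman_stanley_bound (R : realType) (n : nat) (t lam : 'I_n -> nat)
    (i : 'I_n) :
  (forall i : 'I_n, lam i = (\sum_(j < n | (i <= j)%N) t j)%N) ->
  \sum_(j < n | (n <= j + i.+1)%N)
    (if j.+1 == n then (t j)%:R - 1 else (t j)%:R) =
  (lam (rev_ord i))%:R - 1 :> R.
Proof.
case: n t lam i => [_ _ [] //|n] t lam i hlam.
rewrite hlam natr_sum (bigD1 ord_max) /= ?leq_addr 1?addnS ?ltnS ?leq_addr //.
rewrite [in RHS](bigD1 ord_max) /= ?subSS ?leq_subr //.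
rewrite eqxx addrAC; congr (_ + _ - _).
apply: eq_big => [j|j /andP[_ nj]]; first by rewrite addnS ltnS leq_subLR addnC.
by case: eqP => // -[jn]; case/eqP: nj; exact: val_inj.
Qed.

Lemma pitman_stanley_staircase (R : realType) (n : nat) (t lam : 'I_n -> nat)
    (y : 'rV[R]_n) :
  (forall i : 'I_n, lam i = (\sum_(j < n | (i <= j)%N) t j)%N) ->
  (forall i, 0 <= y 0 i) -> @lattice_points R n y ->
  pitman_stanley
    (fun j : 'I_n => if j.+1 == n then (t j)%:R - 1 else (t j)%:R : R) y <->
  staircase_seq lam (heights y).
Proof.
move=> hlam y0 yZ.
(* Between naturals, being at most [lam (rev_ord i)] minus 1 is the strict bound of a staircase
   sequence. *)
have step i : (partial_sum y i <= \sum_(j < n | (n <= j + i.+1)%N)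
    (if j.+1 == n then (t j)%:R - 1 else (t j)%:R)) =
    (nth 0 (heights y) i < lam (rev_ord i))%N.
  rewrite (pitman_stanley_bound _ _ hlam) -nth_heights //.
  by rewrite lerBrDr natr1 ler_nat.
split=> [Py|[_ _ st] i]; last by split; [exact: y0 | rewrite step].
have sz : size (heights y) = n by rewrite size_map size_enum_ord.
split=> // [|i]; last by rewrite -step; have [] := Py i.
apply/(sortedP 0) => k; rewrite sz => kn.
have kn' := ltnW kn; rewrite -(ler_nat R).
rewrite (nth_heights (Ordinal kn')) // (nth_heights (Ordinal kn)) //.
(* Sortedness: partial sum [k.+1] exceeds partial sum [k] by a coordinate of [y], which is
   nonnegative. *)
rewrite /partial_sum [leRHS](bigD1 (Ordinal kn)) //= addrC.
rewrite (eq_bigl (fun j : 'I_n => (j <= k.+1)%N && (j != Ordinal kn))).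
  by rewrite lerDl y0.
by move=> j; rewrite -val_eqE /= andbC -ltn_neqAle ltnS.
Qed.

Unset Implicit Arguments.
Set Strict Implicit.

Theorem corollary4p7 (R : realType) (n : nat) (hn : (0 < n)%N)
    (t : 'I_n -> nat) (ht : forall i : 'I_n, (0 < t i)%N)
    (lam : 'I_n -> nat)
    (hlam : forall i : 'I_n, lam i = (\sum_(j < n | (i <= j)%N) t j)%N) :
  pitman_stanley
      (fun j : 'I_n => if j.+1 == n then (t j)%:R - 1 else (t j)%:R : R)
    `&` @lattice_points R n
  #= `I_(nb_monomials (Omega lam)).
Proof.
have lam_anti (i j : 'I_n) : (i <= j)%N -> (lam j <= lam i)%N.
  move=> ij; rewrite !hlam [leqRHS](bigID (fun k : 'I_n => (j <= k)%N)) /=.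
  rewrite (eq_bigl (fun k : 'I_n => (i <= k)%N && (j <= k)%N)) ?leq_addr //.
  by move=> k; case: (leqP j k) => [/(leq_trans ij) ->|]; rewrite ?andbF.
set N := \max_(i < n) lam i.
have lamN i : (lam i <= N)%N by exact: leq_bigmax.
set p := Omega lam; apply/card_set_bijP.
have suppP (m : 'X_{1.. N}) := msupp_prod_staircase m lamN lam_anti.
(* The bijection sends a lattice point to the position of its monomial in the list of the
   support. *)
exists (fun y : 'rV[R]_n => index (occ_mnm N (heights y)) (msupp p)).
have stP (y : 'rV[R]_n) : pitman_stanley
      (fun j : 'I_n => if j.+1 == n then (t j)%:R - 1 else (t j)%:R : R) y ->
    lattice_points y -> staircase_seq lam (heights y).
  by move=> Py yZ; apply/(pitman_stanley_staircase hlam) => // i; case: (Py i).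
split.
- move=> y [Py yZ] /=; rewrite index_mem; apply/suppP.
  by exists (heights y); [exact: stP|].
- move=> y y' /set_mem[Py yZ] /set_mem[Py' y'Z] E.
  have st := stP _ Py yZ; have st' := stP _ Py' y'Z.
  (* Both monomials lie in the support, so equal positions give equal monomials; the heights are
     then permutations of each other, and both are sorted. *)
  have hyy' : heights y = heights y'.
    have [_ ss _] := st; have [_ ss' _] := st'.
    apply: (sorted_eq leq_trans anti_leq) => //; apply: (@occ_mnm_perm N).
    + exact: staircase_seq_lt st.
    + exact: staircase_seq_lt st'.
    + by apply: (index_inj 0%MM _ _ E); apply/suppP;
        [exists (heights y) | exists (heights y')].
  apply: partial_sum_inj => i.
  rewrite -!nth_heights ?hyy' // => j; [by case: (Py' j)|by case: (Py j)].
- move=> k /= kp.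
  have : nth 0%MM (msupp p) k \in msupp p by exact: mem_nth.
  move=> /suppP[s st E]; have [sz ss _] := st.
  (* The [k]-th monomial comes from the staircase sequence [s], whose differences give the preimage;
     its position is [k] because the support has no repetition. *)
  exists (steps R n s); last by rewrite heights_steps // -E index_uniq.
  have sZ : lattice_points (steps R n s).
    by move=> i; rewrite mxE rpredB ?natr_int.
  split=> //; apply/(pitman_stanley_staircase hlam) => // [i|].
    exact: steps_ge0.
  by rewrite heights_steps.
Qed.
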